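(* Let $(V,g)$ be an inner product vector space over $k$, with $k=\mathbb{R}$ or $k=\mathbb{C}$ (possibly infinite-dimensional), and let $\varphi\in\operatorname{End}_k(V)$ be a finite potent endomorphism with $i(\varphi)\leq 1$. Then the core inverse $\varphi^{(\#)}$ is admissible for the Moore-Penrose inverse, and $$(\varphi^{(\#)})^{\dagger}(v)=\begin{cases}\varphi(v) & \text{if } v\in\operatorname{Im}(\varphi),\\ 0 & \text{if } v\in[\operatorname{Im}(\varphi)]^{\perp}.\end{cases}$$
   Context: An endomorphism $\varphi$ of $V$ is finite potent if $\varphi^n(V)$ is finite-dimensional for some $n$. Equivalently, there is a (unique) $\varphi$-invariant decomposition $V=W_\varphi\oplus U_\varphi$ (AST-decomposition) with $\varphi|_{U_\varphi}$ nilpotent, $W_\varphi$ finite-dimensional and $\varphi|_{W_\varphi}$ an automorphism of $W_\varphi$. The index $i(\varphi)$ is the nilpotency order of $\varphi|_{U_\varphi}$; $i(\varphi)\le 1$ iff $W_\varphi=\operatorname{Im}(\varphi)$ iff $U_\varphi=\operatorname{Ker}(\varphi)$. A linear map $\theta\in\operatorname{End}_k(V)$ is admissible for the Moore-Penrose inverse if $V=\operatorname{Ker}(\theta)\oplus[\operatorname{Ker}(\theta)]^{\perp}$ and $V=\operatorname{Im}(\theta)\oplus[\operatorname{Im}(\theta)]^{\perp}$. In that case the Moore-Penrose inverse $\theta^\dagger$ is the unique linear map with $\theta\theta^\dagger\theta=\theta$, $\theta^\dagger\theta\theta^\dagger=\theta^\dagger$ and both $\theta^\dagger\theta$ and $\theta\theta^\dagger$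 self-adjoint with respect to $g$; explicitly $\theta^\dagger=(\theta|_{[\operatorname{Ker}(\theta)]^\perp})^{-1}$ on $\operatorname{Im}(\theta)$ and $0$ on $[\operatorname{Im}(\theta)]^\perp$. For $\varphi$ finite potent with $i(\varphi)\le 1$ one has $V=\operatorname{Im}(\varphi)\oplus[\operatorname{Im}(\varphi)]^{\perp}$, and the core inverse $\varphi^{(\#)}$ is the unique linear map with $\varphi\circ\varphi^{(\#)}=P_{\operatorname{Im}(\varphi)}$ (the orthogonal projection onto $\operatorname{Im}(\varphi)$ induced by this decomposition) and $\operatorname{Im}(\varphi^{(\#)})\subseteq\operatorname{Im}(\varphi)$. *)

(* Defs.v *)
From HB Require Import structures.
From mathcomp Require Import all_boot all_order all_algebra sesquilinear.
From mathcomp Require Import boolp classical_sets functions cardinality reals.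
From mathcomp Require Import complex.

Set Implicit Arguments.
Unset Strict Implicit.
Unset Printing Implicit Defensive.

Import Order.TTheory GRing.Theory Num.Theory Num.Def.

Local Open Scope classical_set_scope.
Local Open Scope ring_scope.

Section Subspaces.
Variables (K : fieldType) (V : lmodType K).
Implicit Types (A B : set V).

Definition subspace A : Prop := submod_closed [in A].

Definition span (s : seq V) : set V :=
  [set v | exists c : 'I_(size s) -> K, v = \sum_i c i *: s`_i].

Definition finite_dim A : Prop := exists s : seq V, A = span s.

(* V = A (+) B, for A and B subspaces of V *)
Definition dsum A B : Prop :=
  A `&` B = [set 0] /\ forall v, exists a b, [/\ A a, B b & v = a + b].

Definition ker (f : V -> V) : set V := f @^-1` [set 0].

End Subspaces.

Section FinitePotent.
Variables (K : fieldType) (V : lmodType K).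
Implicit Types (phi : {linear V -> V}) (W U : set V).

Definition finite_potent phi : Prop :=
  exists n, finite_dim (range (iter n phi)).

Definition nilpotent_on phi U (n : nat) : Prop :=
  forall u, U u -> iter n phi u = 0.

(* phi @` U `<=` U is U being phi-invariant; the invariance of W is part of
   phi being a bijection of W onto itself. *)
Definition AST_decomposition phi W U : Prop :=
  [/\ subspace W /\ subspace U,
      dsum W U,
      phi @` U `<=` U /\ (exists n, nilpotent_on phi U n),
      finite_dim W
    & set_bij W W phi].

Definition nilpotency_order phi U (n : nat) : Prop :=
  nilpotent_on phi U n /\ forall m, nilpotent_on phi U m -> (n <= m)%N.

(* The index i(phi); the value 0 is junk when phi has no AST-decomposition,
   i.e., when it is not finite potent. *)
Definition fp_index phi : nat :=
  xget 0%N [set n | exists W U,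
    AST_decomposition phi W U /\ nilpotency_order phi U n].

End FinitePotent.

(* The linear map satisfying P; it is the zero map if there is none. *)
Definition the_linear (K : fieldType) (V : lmodType K)
    (P : {linear V -> V} -> Prop) : {linear V -> V} :=
  if pselect (exists f, P f) is left exP then projT1 (cid exP) else \0.

Section InnerProduct.
Variables (K : numFieldType) (theta : K -> K) (V : lmodType K).
Variable g : {dot V for theta}.
Implicit Types (A : set V) (f h phi : {linear V -> V}).

Definition orthoc A : set V := [set v | forall u, A u -> g u v = 0].

Definition selfadjoint (f : V -> V) : Prop :=
  forall u v, g (f u) v = g u (f v).

(* p is the projection onto A along its orthogonal complement; it determines p
   only when dsum A (orthoc A) holds. *)
Definition orth_proj A (p : V -> V) : Prop :=
  (forall v, A v -> p v = v) /\ (forall v, orthoc A v -> p v = 0).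

Definition MP_admissible f : Prop :=
  dsum (ker f) (orthoc (ker f)) /\ dsum (range f) (orthoc (range f)).

Definition is_MP_inverse f h : Prop :=
  [/\ f \o h \o f =1 f,
      h \o f \o h =1 h,
      selfadjoint (h \o f)
    & selfadjoint (f \o h)].

Definition MP_inverse f : {linear V -> V} := the_linear (is_MP_inverse f).

Definition is_core_inverse phi h : Prop :=
  orth_proj (range phi) (phi \o h) /\ range h `<=` range phi.

Definition core_inverse phi : {linear V -> V} :=
  the_linear (is_core_inverse phi).

End InnerProduct.

(* Main.v *)
Require Import Defs.
From HB Require Import structures.
From mathcomp Require Import all_boot all_order all_algebra sesquilinear.
From mathcomp Require Import boolp classical_sets functions cardinality reals.
From mathcomp Require Import complex.

Set Implicit Arguments.
Unset Strict Implicit.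
Unset Printing Implicit Defensive.

Import Order.TTheory GRing.Theory Num.Theory Num.Def.

Local Open Scope classical_set_scope.
Local Open Scope complex_scope.
Local Open Scope ring_scope.

(** Fitting's lemma applied on the finite-dimensional range of some phi^n gives
    the AST-decomposition, and index at most 1 then says that phi permutes the
    finite-dimensional space W = Im(phi), so that V = W (+) W^perp. The core
    inverse h is (phi|W)^-1 after the orthogonal projection P onto W; hence
    Im(h) = W and Ker(h) = W^perp, which gives admissibility. The map phi o P
    satisfies the Moore-Penrose equations for h. Conversely, for any solution T,
    T h and h T are self-adjoint idempotents, and this forces T = phi on W and
    T = 0 on W^perp. *)

(** * Subspaces, spans and linear maps *)

Section Subspaces.
Variables (K : fieldType) (V : lmodType K).
Implicit Types (A : set V) (f : {linear V -> V}) (s : seq V) (u v x : V).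

Lemma subspace_comb A a u v : subspace A -> A u -> A v -> A (a *: u + v).
Proof.
by move=> [_ subA] Au Av; apply/set_mem/subA; apply/mem_set.
Qed.

Lemma subspaceB A u v : subspace A -> A u -> A v -> A (u - v).
Proof. by move=> subA Au Av; rewrite addrC -scaleN1r; exact: subspace_comb. Qed.

Lemma subspace_range f : subspace (range f).
Proof.
split=> [|a u v]; rewrite !inE; first by exists 0; rewrite ?linear0.
by move=> [x _ <-] [y _ <-]; exists (a *: x + y); rewrite ?linearP.
Qed.

Lemma subspace_ker f : subspace (ker f).
Proof.
split=> [|a u v]; rewrite !inE /ker /= ?linear0 // linearP => -> ->.
by rewrite scaler0 addr0.
Qed.

(** This allows induction on the spanning family in place of sums indexed by ['I_(size s)]. *)
Lemma span_cons s x v :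
  Defs.span (x :: s) v <-> exists a u, Defs.span s u /\ v = a *: x + u.
Proof.
split=> [[c ->]|[a [u [[c ->] ->]]]].
  exists (c ord0), (\sum_i c (lift ord0 i) *: s`_i).
  by split; [exists (fun i => c (lift ord0 i)) | rewrite big_ord_recl].
exists (fun i => if unlift ord0 i is Some j then c j else a).
rewrite big_ord_recl unlift_none /=; congr (_ + _).
by apply: eq_bigr => i _; rewrite liftK.
Qed.

Lemma image_span f s : f @` Defs.span s = Defs.span (map f s).
Proof.
elim: s => [|x s IHs]; apply/seteqP; split=> v.
- move=> [_ [c ->] <-]; rewrite big_ord0 linear0.
  by exists (fun=> 0); rewrite big_ord0.
- move=> [c ->]; exists 0; last by rewrite big_ord0 linear0.
  by exists (fun=> 0); rewrite big_ord0.
- move=> [z /span_cons[a [u [su ->]]] <-]; apply/span_cons.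
  by exists a, (f u); rewrite linearP -IHs; split=> //; exists u.
move=> /span_cons[a [y []]]; rewrite -IHs => -[u su <-] ->.
by exists (a *: x + u); rewrite ?linearP //; apply/span_cons; exists a, u.
Qed.

Lemma finite_dim_image f A : finite_dim A -> finite_dim (f @` A).
Proof. by move=> [s ->]; exists (map f s); exact: image_span. Qed.

(** Choice gives a function; uniqueness of values turns the closure of [r] under linear combinations
    into linearity. *)
Lemma linear_of_functional_rel (r : V -> V -> Prop) :
  (forall v, exists w, r v w) ->
  (forall v w w', r v w -> r v w' -> w = w') ->
  (forall a u x v y, r u x -> r v y -> r (a *: u + v) (a *: x + y)) ->
  exists f : {linear V -> V}, forall v, r v (f v).
Proof.
move=> rex runiq rlin; have [f fP] := choice rex.
have f_lin : linear f.
  by move=> a u v; apply: runiq (fP _) _; apply: rlin.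
pose fL : {linear V -> V} :=
  HB.pack f (GRing.isLinear.Build K V V *:%R f f_lin).
by exists fL.
Qed.

End Subspaces.

Lemma the_linearP (K : fieldType) (V : lmodType K)
    (P : {linear V -> V} -> Prop) : (exists f, P f) -> P (the_linear P).
Proof. by rewrite /the_linear; case: pselect => // exP _; case: cid. Qed.

(* Cayley-Hamilton, after factoring the characteristic polynomial as
   q * X^a with q(0) != 0. *)
Lemma mx_strongly_pi_regular (K : fieldType) n (A : 'M[K]_n.+1) :
  exists a r, A ^+ a = horner_mx A r * A ^+ a.+1.
Proof.
have [a [q]] := multiplicity_XsubC (char_poly A) 0.
rewrite monic_neq0 ?char_poly_monic //= => q0 pE.
have /eqP := Cayley_Hamilton A.
rewrite pE subr0 rmorphM rmorphXn /= horner_mx_X => /eqP qA.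
(* Write q = q(0) + d X with d = [drop_poly 1 q]. Then q(A) A^a = 0 reads q(0) A^a = - d(A) A^(a+1),
   and q(0) is invertible. *)
exists a, (- (q.[0]^-1) *: drop_poly 1 q).
have -> : A ^+ a = (q.[0]^-1)%:M * ((q.[0])%:M * A ^+ a).
  by rewrite mulrA -[_%:M * _%:M]scalar_mxM mulVf // mul1r.
have -> : (q.[0])%:M * A ^+ a = - (horner_mx A (drop_poly 1 q) * A ^+ a.+1).
  apply/eqP; rewrite -addr_eq0 -[X in _ == X]qA -{3}(poly_take_drop 1 q).
  rewrite rmorphD rmorphM /= horner_mx_X exprS mulrA -mulrDl.
  rewrite -(horner_mx_C A); suff -> : take_poly 1 q = (q.[0])%:P by [].
  by rewrite horner_coef0; apply/polyP=> -[|i]; rewrite coef_take_poly coefC.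
by rewrite linearZ /= -scalerAl scaleNr mulrN; congr -%R; exact: mul_scalar_mx.
Qed.

(** * The AST-decomposition and the index *)

Section AST.
Variables (K : fieldType) (V : lmodType K) (phi : {linear V -> V}).
Implicit Types (u v w : V) (p q : {poly K}).

Lemma iter_is_linear n : linear (iter n phi).
Proof. by elim: n => // n IHn a u v; rewrite !iterS IHn linearP. Qed.

HB.instance Definition _ n :=
  GRing.isLinear.Build K V V *:%R (iter n phi) (iter_is_linear n).

(** This is p(phi) applied to v, the counterpart on [V] of [horner_mx]. *)
Definition poly_act p v : V := \sum_(i < size p) p`_i *: iter i phi v.

Lemma iter_poly_act n p v :
  iter n phi (poly_act p v) = poly_act p (iter n phi v).
Proof.
rewrite /poly_act linear_sum; apply: eq_bigr => i _.
by rewrite linearZ /= -!iterD addnC.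
Qed.

Lemma poly_act0 p : poly_act p 0 = 0.
Proof. by apply: big1 => i _; rewrite linear0 scaler0. Qed.

(** On the finite-dimensional invariant subspace Im(phi^n), [phi] acts through a matrix A. The
    relation A^a = p(A) A^(a+1), applied to phi^n v, gives the claim with m = a + n. *)
Lemma strongly_pi_regular : finite_potent phi ->
  exists m p, finite_dim (range (iter m phi)) /\
    forall v, iter m phi v = iter m.+1 phi (poly_act p v).
Proof.
(* Adding the vector 0 keeps the span and makes the size a successor, so that the square matrices
   form a ring. *)
move=> [n [s0 rangeE]]; pose s := 0 :: s0; pose k := size s0.
have {}rangeE : range (iter n phi) = Defs.span s.
  rewrite rangeE; apply/seteqP; split=> v.
    by move=> sv; apply/span_cons; exists 0, v; rewrite scaler0 add0r.
  by move=> /span_cons[a [u [su ->]]]; rewrite scaler0 add0r.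
(* [s] may be linearly dependent: [T] maps coordinates onto Im(phi^n), perhaps not injectively, and
   [A] below is a lift of [phi] along [T]. *)
pose T (c : 'rV[K]_k.+1) := \sum_i c 0 i *: s`_i.
have TP v : range (iter n phi) v -> exists c, v = T c.
  rewrite rangeE => -[c ->]; exists (\row_i c i).
  by apply: eq_bigr => i _; rewrite mxE.
have phi_s (i : 'I_k.+1) : exists c, phi s`_i = T c.
  have : range (iter n phi) s`_i.
    rewrite rangeE; exists (fun j => (j == i)%:R).
    rewrite (bigD1 i) //= eqxx scale1r big1 ?addr0 // => j /negPf ->.
    by rewrite scale0r.
  by move=> [x _ <-]; apply: TP; exists (phi x) => //; rewrite -iterSr.
have [c_ cP] := choice phi_s; pose A := \matrix_i c_ i.
have TA c : T (c *m A) = phi (T c).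
  rewrite linear_sum /=; under [RHS]eq_bigr => i _ do
    rewrite linearZ /= cP scaler_sumr.
  rewrite exchange_big; apply: eq_bigr => j _.
  rewrite mxE scaler_suml; apply: eq_bigr => i _.
  by rewrite scalerA !mxE.
have TAX c i : T (c *m A ^+ i) = iter i phi (T c).
  by elim: i => [|i IHi]; rewrite ?mulmx1 // exprSr mulmxA TA IHi.
have TAr c p : T (c *m horner_mx A p) = poly_act p (T c).
  rewrite -{1}[p]coefK poly_def rmorph_sum /= mulmx_sumr /poly_act.
  under [RHS]eq_bigr => i _ do rewrite -TAX scaler_sumr.
  rewrite exchange_big; apply: eq_bigr => j _.
  rewrite summxE scaler_suml; apply: eq_bigr => i _.
  by rewrite linearZ /= rmorphXn /= horner_mx_X -scalemxAr mxE scalerA.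
have [a [p Ap]] := mx_strongly_pi_regular A.
exists (a + n)%N, p; split=> [|v].
  have -> : range (iter (a + n) phi) = iter a phi @` range (iter n phi).
    apply/seteqP; split=> y [x].
      by move=> _ <-; exists (iter n phi x); rewrite -?iterD //; exists x.
    by move=> [z _ <-] <-; exists z; rewrite // iterD.
  by apply: finite_dim_image; exists s.
have [c vE] : exists c, iter n phi v = T c by apply: TP; exists v.
by rewrite -addSn !iterD iter_poly_act vE -TAX Ap mulmxA TAX TAr.
Qed.

(* Since phi^m = phi^(m+1) b with b commuting with phi, one gets
   phi^m = phi^(2m) b^m, so v - phi^m b^m v lies in the kernel of phi^m. *)
Lemma AST_decomposition_exists :
  finite_potent phi -> exists W U, AST_decomposition phi W U.
Proof.
move=> /strongly_pi_regular[m [p [fdW bP]]].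
have bmP k v : iter m phi v = iter (k + m) phi (iter k (poly_act p) v).
  by elim: k => // k IHk; rewrite IHk iterD bP -iterD addnS.
have bC k v : iter k (poly_act p) (iter m phi v) =
              iter m phi (iter k (poly_act p) v).
  by elim: k => //= k ->; rewrite iter_poly_act.
have b0 k : iter k (poly_act p) 0 = 0.
  by elim: k => //= k ->; rewrite poly_act0.
exists (range (iter m phi)), (ker (iter m phi)).
split=> //.
- by split; [apply: subspace_range | apply: subspace_ker].
- split.
    apply/seteqP; split=> [v [[x _ <-]]|v ->]; last first.
      by split; [exists 0; rewrite ?linear0 | rewrite /ker /= linear0].
    rewrite /ker /= => x0.
    by rewrite (bmP m x) iterD -!bC x0 b0.
  move=> v; pose w := iter m phi (iter m (poly_act p) v).
  exists w, (v - w); split; last by rewrite addrC subrK.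
    by exists (iter m (poly_act p) v).
  by rewrite /ker /= linearB /= (bmP m v) iterD subrr.
- split; last by exists m.
  by move=> _ [x kx <-]; rewrite /ker /= -iterSr iterS kx linear0.
split.
- by move=> _ [x _ <-]; exists (phi x); rewrite // -iterSr.
(* Since phi^m = b phi^(m+1), whatever phi^(m+1) kills is already killed by phi^m; apply this to x -
   y. *)
- move=> u v; rewrite !inE => -[x _ <-] [y _ <-] /eqP.
  rewrite -subr_eq0 -!linearB /= => /eqP xy0.
  by apply/eqP; rewrite -subr_eq0 -linearB /= bP iter_poly_act /= xy0 poly_act0.
move=> _ [x _ <-]; exists (iter m phi (poly_act p x)); last by rewrite [RHS]bP.
by exists (poly_act p x).
Qed.

(* If there were no AST-decomposition, fp_index would be the junk value 0 and
   the bound would say nothing; finite potency excludes this. *)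
Lemma fp_index_le1 : finite_potent phi -> (fp_index phi <= 1)%N ->
  finite_dim (range phi) /\ set_bij (range phi) (range phi) phi.
Proof.
move=> fp; have [W0 [U0 AST0]] := AST_decomposition_exists fp.
rewrite /fp_index; case: xgetP => [n _ [W [U [AST [nil _]]]] n1|none _].
  have [_ dsumWU _ fdW bijW] := AST; have [homW _ surjW] := bijW.
  suff -> : range phi = W by [].
  apply/seteqP; split=> [_ [v _ <-]|w /surjW[x _ <-]]; last by exists x.
  have [_ /(_ v)[a [b [Wa Ub ->]]]] := dsumWU.
  rewrite linearD (_ : phi b = 0) ?addr0; first exact: homW.
  (* Order 0 forces b = 0, and order 1 says directly that [phi] kills b. *)
  by move: (nil b Ub); case: n n1 {nil} => [|[]] //= _ ->; rewrite linear0.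
exfalso; have [_ _ [_ [n0 nil0]] _ _] := AST0.
have ex_n : exists n, `[< nilpotent_on phi U0 n >] by exists n0; apply/asboolP.
case: (ex_minnP ex_n) => n /asboolP nil_n min_n; apply: (none n).
by exists W0, U0; split=> //; split=> // m nil_m; apply/min_n/asboolP.
Qed.

End AST.

(** * Orthogonal projections, the core inverse and its Moore-Penrose inverse *)

Section InnerProduct.
Variables (K : numFieldType) (theta : K -> K) (V : lmodType K).
Variable g : {dot V for theta}.
Implicit Types (A : set V) (s : seq V) (u v w : V) (f h phi : {linear V -> V}).

Lemma dotC u v : g v u = theta (g u v).
Proof. by rewrite (hermitian_subproof (s := g)) mul1r. Qed.

Lemma dotBl u v w : g (u - v) w = g u w - g v w.
Proof. exact: zmod_morphisml_subproof. Qed.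

Lemma dotBr u v w : g w (u - v) = g w u - g w v.
Proof. exact: zmod_morphismr_subproof. Qed.

Lemma dotZl a u w : g (a *: u) w = a * g u w.
Proof. exact: linearl_subproof. Qed.

Lemma dotZr a u w : g w (a *: u) = theta a * g w u.
Proof. exact: linearr_subproof. Qed.

Lemma dot0l u : g 0 u = 0.
Proof. by rewrite -(subrr 0) dotBl subrr. Qed.

Lemma dot0r u : g u 0 = 0.
Proof. by rewrite -(subrr 0) dotBr subrr. Qed.

Lemma dotDl u v w : g (u + v) w = g u w + g v w.
Proof. by rewrite -{1}[v]opprK -[- v]sub0r !dotBl dot0l sub0r opprK. Qed.

Lemma dotDr u v w : g w (u + v) = g w u + g w v.
Proof. by rewrite -{1}[v]opprK -[- v]sub0r !dotBr dot0r sub0r opprK. Qed.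

Lemma dot_eq0 u : g u u = 0 -> u = 0.
Proof.
move=> guu; apply: contrapT => /eqP /(neq0_dnorm_gt0 (s := g)).
by rewrite guu ltxx.
Qed.

(** [theta] is a bare function here; theta 0 = 0 is read off the hermitian symmetry at the pair (0,
    0). *)
Lemma dot_orth_sym u v : g u v = 0 -> g v u = 0.
Proof.
by move=> uv0; rewrite dotC uv0; have := dotC 0 0; rewrite dot0l => <-.
Qed.

Lemma subspace_orthoc A : subspace (orthoc g A).
Proof.
split=> [|a u v]; rewrite !inE /orthoc /=; first by move=> u _; exact: dot0r.
by move=> uA vA w Aw; rewrite dotDr dotZr uA // vA // mulr0 addr0.
Qed.

Lemma orthoc_inter A v : A v -> orthoc g A v -> v = 0.
Proof. by move=> Av /(_ v Av) /dot_eq0. Qed.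

(** Gram-Schmidt by induction: the new vector x is replaced by its residual y orthogonal to the
    earlier span, and the component of v - p along y is removed. *)
Lemma span_orthoc_add s v :
  exists2 p, Defs.span s p & orthoc g (Defs.span s) (v - p).
Proof.
elim: s v => [|x s IHs] v.
  exists 0; first by exists (fun=> 0); rewrite big_ord0.
  by move=> _ [c ->]; rewrite big_ord0 dot0l.
have [p sp v_p] := IHs v; have [q sq x_q] := IHs x.
pose y := x - q; pose c := g (v - p) y / g y y.
(* When g y y = 0, y itself vanishes, so the junk quotient [c] does no harm. *)
have yc : g (v - p - c *: y) y = 0.
  rewrite dotBl dotZl; have [/dot_eq0 ->|gyy] := eqVneq (g y y) 0.
    by rewrite !dot0r mulr0 subr0.
  by rewrite divfK // subrr.
have scomb a u w : Defs.span s u -> Defs.span s w -> Defs.span s (a *: u + w).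
  move=> [d ->] [e ->]; exists (fun i => a * d i + e i).
  rewrite scaler_sumr -big_split; apply: eq_bigr => i _ /=.
  by rewrite scalerDl scalerA.
exists (p + c *: y).
  apply/span_cons; exists c, (- c *: q + p); split; first exact: scomb.
  by rewrite scalerBr addrC scaleNr addrA.
move=> _ /span_cons[a [u [su ->]]]; rewrite opprD addrA.
have s_orth w : Defs.span s w -> g w (v - p - c *: y) = 0.
  by move=> sw; rewrite dotBr dotZr v_p // x_q // mulr0 subr0.
rewrite dotDl dotZl (s_orth u su) addr0 -[x](subrK q) dotDl (s_orth q) // addr0.
by rewrite (dot_orth_sym yc) mulr0.
Qed.

Lemma finite_dim_dsum A : finite_dim A -> subspace A -> dsum A (orthoc g A).
Proof.
move=> [s ->] [/set_mem A0 _]; split.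
  apply/seteqP; split=> [v [Av vA]|v ->]; first exact: orthoc_inter Av vA.
  by split=> // u _; exact: dot0r.
move=> v; have [p sp vp] := span_orthoc_add s v.
by exists p, (v - p); split=> //; rewrite addrC subrK.
Qed.

(** Take for h v the unique w in Im(phi) such that phi w is the orthogonal projection of v. It
    exists and is unique because [phi] permutes Im(phi). *)
Lemma core_inverse_exists phi :
  dsum (range phi) (orthoc g (range phi)) ->
  set_bij (range phi) (range phi) phi ->
  exists h, is_core_inverse g phi h.
Proof.
move=> [_ ds] [_ inj surj].
have [|||h hP] := @linear_of_functional_rel K V
  (fun v w => range phi w /\ orthoc g (range phi) (v - phi w)).
- move=> v; have [_ [b [/surj[w Ww <-] Wb ->]]] := ds v.
  by exists w; rewrite addrC addKr.
- move=> v w w' [Ww vw] [Ww' vw']; apply: inj; rewrite ?inE //.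
  apply/eqP; rewrite -subr_eq0; apply/eqP.
  apply: (@orthoc_inter (range phi)).
    by rewrite -linearB; exists (w - w').
  have -> : phi w - phi w' = (v - phi w') - (v - phi w).
    by rewrite opprB [RHS]addrC addrA subrK.
  exact: subspaceB (subspace_orthoc _) _ _.
- move=> a u x v y [Wx ux] [Wy vy]; split.
    exact: subspace_comb (subspace_range _) _ _.
  rewrite linearP opprD addrACA -scalerBr.
  exact: subspace_comb (subspace_orthoc _) _ _.
exists h; split=> [|_ [v _ <-]]; last exact: (hP v).1.
split=> v Av; have [hv vhv] := hP v.
  apply/esym/eqP; rewrite -subr_eq0; apply/eqP.
  apply: (@orthoc_inter (range phi)) => //.
  by apply: (subspaceB (subspace_range phi)) => //; exists (h v).
apply: (@orthoc_inter (range phi)); first by exists (h v).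
have := subspaceB (subspace_orthoc _) Av vhv.
by rewrite opprB addrC subrK.
Qed.

(** If v = a + b is orthogonal to A^perp, pairing it with b leaves g b b = 0. This identifies
    Ker(h)^perp with W once Ker(h) = W^perp is known. *)
Lemma orthoc_orthoc A : dsum A (orthoc g A) -> orthoc g (orthoc g A) = A.
Proof.
move=> [_ ds]; apply/seteqP; split=> [v vA|v Av u uA]; last first.
  by apply: dot_orth_sym; exact: uA.
have [a [b [Aa Ab vE]]] := ds v.
suff b0 : b = 0 by rewrite vE b0 addr0.
apply: dot_eq0; have := vA b Ab.
by rewrite vE dotDr (dot_orth_sym (Ab a Aa)) add0r.
Qed.

Lemma core_inverse_MP phi :
  finite_dim (range phi) -> set_bij (range phi) (range phi) phi ->
  [/\ MP_admissible g (core_inverse g phi),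
      (forall v, range phi v ->
         MP_inverse g (core_inverse g phi) v = phi v)
    & (forall v, orthoc g (range phi) v ->
         MP_inverse g (core_inverse g phi) v = 0)].
Proof.
move=> fd bij; have ds := finite_dim_dsum fd (subspace_range phi).
have [[hW hWo] hR] : is_core_inverse g phi (core_inverse g phi).
  by apply: the_linearP; exact: core_inverse_exists.
move: (core_inverse g phi) hW hWo hR => h hW hWo hR.
set W := range phi in fd bij ds hW hWo hR *.
have {}hW v : W v -> phi (h v) = v by exact: hW.
have {}hWo v : orthoc g W v -> phi (h v) = 0 by exact: hWo.
have [_ inj _] := bij; have [_ dsW] := ds.
have Wh v : W (h v) by apply: hR; exists v.
have Wphi v : W (phi v) by exists v.
have hphi w : W w -> h (phi w) = w.
  by move=> Ww; apply: inj; rewrite ?inE ?hW.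
have kerh : ker h = orthoc g W.
  apply/seteqP; split=> v; last first.
    move=> /hWo pv0; apply: inj; rewrite ?inE ?linear0 //.
    by rewrite -(linear0 phi).
  (* If h (a + b) = 0, then a = phi (h a) + phi (h b) = phi (h (a + b)) = 0. *)
  have [a [b [Wa Wb ->]]] := dsW v => hv0.
  suff -> : a = 0 by rewrite add0r.
  rewrite -(hW a Wa) -[LHS]addr0 -[X in _ + X = _](hWo b Wb).
  by rewrite -!linearD [h (a + b)]hv0 linear0.
have rangeh : range h = W.
  apply/seteqP; split=> // w Ww; exists (phi w) => //; exact: hphi.
have WoI := orthoc_orthoc ds.
have adm : MP_admissible g h.
  rewrite /MP_admissible kerh rangeh WoI; split=> //.
  have [I _] := ds; split; first by rewrite setIC.
  by move=> v; have [a [b [? ? ->]]] := dsW v; exists b, a; rewrite addrC.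
have Psa : selfadjoint g (phi \o h).
  move=> u v /=; have [a [b [Wa Wb ->]]] := dsW u.
  have [c [d [Wc Wd ->]]] := dsW v.
  rewrite !(linearD h) !(linearD phi) /= (hW a Wa) (hWo b Wb).
  rewrite (hW c Wc) (hWo d Wd) !addr0 dotDr dotDl (Wd a Wa) addr0.
  by rewrite (dot_orth_sym (Wb c Wc)) addr0.
(* [MP_inverse] is a chosen solution, so one has to be exhibited first. For phi o P, with P = phi o
   h, both composites with h equal P. *)
have [hTh ThT Thsa hTsa] : is_MP_inverse g h (MP_inverse g h).
  apply: the_linearP; exists (phi \o (phi \o h) : {linear V -> V}).
  split=> [v|v|u v|u v] /=.
  - by rewrite hphi // hW.
  - by rewrite (hphi (phi (h v))) // hphi.
  - by rewrite (hW (h u)) // (hW (h v)) //; exact: Psa.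
  - by rewrite !hphi //; exact: Psa.
move: (MP_inverse g h) hTh ThT Thsa hTsa => T hTh ThT Thsa hTsa.
have {}hTh x : h (T (h x)) = h x by exact: hTh.
have {}ThT x : T (h (T x)) = T x by exact: ThT.
split=> // v Wv; last first.
  (* Here v lies in W^perp. As h T is a self-adjoint idempotent, the square norm of h (T v) is g v
     (h (T v)), which is 0 because h (T v) is in W. *)
  rewrite -ThT; suff -> : h (T v) = 0 by rewrite linear0.
  apply: dot_eq0; rewrite (hTsa v) /= hTh; apply: dot_orth_sym.
  exact: Wv.
(* With x = phi v, the vector T (h x) - x lies in W, since self-adjointness of T h puts its image in
   Ker(h)^perp = W. It also lies in Ker(h) = W^perp by h T h = h. *)
rewrite -{1}(hphi v Wv); apply/eqP; rewrite -subr_eq0; apply/eqP.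
apply: (@orthoc_inter W).
  apply: subspaceB (subspace_range phi) _ (Wphi v).
  rewrite -/W -WoI -kerh => z hz.
  by rewrite -(Thsa z) /= [h z]hz linear0 dot0l.
by rewrite -kerh /ker /= linearB hTh subrr.
Qed.

End InnerProduct.

Theorem corollary4p7 (R : realType) :
  (forall (V : lmodType R) (g : {dot V for idfun}) (phi : {linear V -> V}),
     finite_potent phi -> (fp_index phi <= 1)%N ->
     [/\ MP_admissible g (core_inverse g phi),
         (forall v, range phi v ->
            MP_inverse g (core_inverse g phi) v = phi v)
       & (forall v, orthoc g (range phi) v ->
            MP_inverse g (core_inverse g phi) v = 0)])
  /\
  (forall (V : lmodType R[i]) (g : {dot V for conjC}) (phi : {linear V -> V}),
     finite_potent phi -> (fp_index phi <= 1)%N ->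
     [/\ MP_admissible g (core_inverse g phi),
         (forall v, range phi v ->
            MP_inverse g (core_inverse g phi) v = phi v)
       & (forall v, orthoc g (range phi) v ->
            MP_inverse g (core_inverse g phi) v = 0)]).
Proof.
by split=> V g phi fp /(fp_index_le1 fp)[fd bij]; exact: core_inverse_MP.
Qed.
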